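(* Let $\mu\in\mathcal{M}_0^3$. Then there exists a constant $C=C(\mu)>0$ such that for every integer $n\ge 1$, $$d_{\mathrm{Bool}}\big(\tfrac{1}{\sqrt n}\mu^{\uplus n},\rho_{b}\big)\le \frac{|m_3(\mu)|+C}{\sqrt n}.$$ In particular, $\tfrac{1}{\sqrt n}\mu^{\uplus n}$ converges weakly to $\rho_{b}$ as $n\to\infty$. If in addition $m_3(\mu)=0$ and $m_4(\mu)<\infty$, then there is a (different) constant $C=C(\mu)>0$ such that for every $n\ge 1$, $$d^{(3)}_{\mathrm{Bool}}\big(\tfrac{1}{\sqrt n}\mu^{\uplus n},\rho_{b}\big)\le \frac{|m_4(\mu)|+C}{n}.$$
   Context: For a Borel probability measure $\mu$ on $\mathbb{R}$, $m_k(\mu)$ is its $k$-th moment. $\mathcal{M}^k$ is the set of Borel probability measures on $\mathbb{R}$ whose moments of order $j$ are finite for all $j\le k$, and $\mathcal{M}_0^k=\{\mu\in\mathcal{M}^k: m_1(\mu)=0,\ m_2(\mu)=1\}$. For $\lambda>0$, $\lambda\mu$ denotes the dilation $(\lambda\mu)(A)=\mu(A/\lambda)$. Cauchy transform: $G_\mu(z)=\int_{\mathbb{R}}\frac{d\mu(t)}{z-t}$ for $z\in\mathbb{C}\setminus\mathbb{R}$. The self-energy of $\mu$ is $E_\mu(z)=z-1/G_\mu(z)$; it determines $\mu$. The Boolean convolution $\mu\uplus\nu$ is the probability measure with $E_{\mu\uplus\nu}=E_\mu+E_\nu$; $\mu^{\uplus n}$ is the $n$-fold Boolean convolution of $\mu$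 with itself. $\rho_b=\frac12(\delta_1+\delta_{-1})$, with $E_{\rho_b}(1/z)=z$. For $\alpha,\beta>0$ let $\Delta_{\alpha,\beta}=\{x+iy\in\mathbb{C}^-: |x|<-\alpha y,\ y>-\beta\}$, with $\mathbb{C}^-$ the open lower half-plane. Fix $\epsilon>0$ small enough that $\Delta_{\epsilon,\epsilon}\subseteq\{|z+i/4|<1/4\}$. For $k\ge 2$, $$d^{(k)}_{\mathrm{Bool}}(\mu,\nu)=\sup_{z\in\Delta_{\epsilon,\epsilon}}\frac{|E_\mu(1/z)-E_\nu(1/z)|}{|z|^k},\qquad d_{\mathrm{Bool}}:=d^{(2)}_{\mathrm{Bool}}.$$ *)

(* Defs.v *)
From HB Require Import structures.
From mathcomp Require Import all_boot all_order all_algebra.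
From mathcomp Require Import all_classical all_reals all_analysis.
From mathcomp Require Import complex.

Set Implicit Arguments.
Unset Strict Implicit.
Unset Printing Implicit Defensive.

Import Order.TTheory GRing.Theory Num.Theory.
Import numFieldNormedType.Exports.
Import ComplexField.Normc.

Local Open Scope classical_set_scope.
Local Open Scope ring_scope.
Local Open Scope complex_scope.

Notation prob R := (probability (measurableTypeR R) R).

Definition moment (R : realType) (k : nat) (mu : prob R) : R :=
  \int[mu]_t (t ^+ k).

Definition finite_moment (R : realType) (k : nat) (mu : prob R) : Prop :=
  mu.-integrable setT (fun t : measurableTypeR R => (t ^+ k)%:E).

Definition finite_moments (R : realType) (k : nat) : set (prob R) :=
  [set mu | forall j : nat, (j <= k)%N -> finite_moment j mu].

Definition standardized (R : realType) (k : nat) : set (prob R) :=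
  [set mu | [/\ finite_moments k mu, moment 1 mu = 0 & moment 2 mu = 1]].

Section dilation.
Context {R : realType}.

Definition scaling (l : R) (t : measurableTypeR R) : measurableTypeR R :=
  (l * t)%R.

Let measurable_scaling (l : R) : measurable_fun setT (scaling l).
Proof. exact: measurable_realfun.mulrl_measurable. Qed.

HB.instance Definition _ (l : R) :=
  isMeasurableFun.Build _ _ _ _ (scaling l) (measurable_scaling l).

(* For l > 0 the preimage of A under t |-> l * t is A / l. *)
Definition dilate (l : R) (mu : prob R) : prob R := distribution mu (scaling l).

End dilation.

Section symmetric_bernoulli.
Context {R : realType}.

Definition rho_b : set (measurableTypeR R) -> \bar R :=
  measure_add (mscale (2^-1)%:nng (\d_(1 : measurableTypeR R)))
              (mscale (2^-1)%:nng (\d_(- 1 : measurableTypeR R))).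

HB.instance Definition _ := Measure.on rho_b.

Let rho_b_setT : rho_b setT = 1%E.
Proof.
rewrite /rho_b measure_addE /= /mscale /= /dirac !indicE !in_setT !mule1 -EFinD /=.
by congr EFin; rewrite [RHS]splitr div1r.
Qed.

HB.instance Definition _ :=
  Measure_isProbability.Build _ _ R rho_b rho_b_setT.

End symmetric_bernoulli.

(* The integral of a complex-valued function is taken componentwise. *)
Definition cauchy_transform (R : realType) (mu : prob R) (z : R[i]) : R[i] :=
  (\int[mu]_t complex.Re (1 / (z - t%:C))) +i*
  (\int[mu]_t complex.Im (1 / (z - t%:C))).

Definition self_energy (R : realType) (mu : prob R) (z : R[i]) : R[i] :=
  z - 1 / cauchy_transform mu z.

(* Boolean convolution as a relation: E_rho determines rho, so mu and nu have
   at most one Boolean convolution rho. *)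
Definition is_bool_conv (R : realType) (mu nu rho : prob R) : Prop :=
  forall z : R[i], complex.Im z != 0 ->
    self_energy rho z = self_energy mu z + self_energy nu z.

Inductive is_bool_pow (R : realType) (mu : prob R) : nat -> prob R -> Prop :=
| is_bool_pow1 : is_bool_pow mu 1 mu
| is_bool_powS (n : nat) (nu rho : prob R) :
    is_bool_pow mu n nu -> is_bool_conv nu mu rho -> is_bool_pow mu n.+1 rho.

Definition truncated_cone (R : realType) (a b : R) : set R[i] :=
  [set z | [/\ complex.Im z < 0, `|complex.Re z| < - a * complex.Im z
             & - b < complex.Im z]].

(* Valued in the extended reals, so that a bound includes finiteness. *)
Definition dBool (R : realType) (eps : R) (k : nat) (mu nu : prob R) : \bar R :=
  ereal_sup [set (normc (self_energy mu (1 / z) - self_energy nu (1 / z))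
                  / normc z ^+ k)%:E | z in truncated_cone eps eps].

Definition weakly_converges (R : realType) (mu_ : nat -> prob R) (mu : prob R)
  : Prop :=
  forall f : R -> R, continuous f -> bounded_fun f ->
    \int[mu_ n]_t f t @[n --> \oo] --> \int[mu]_t f t.

(* Main.v *)
(* Write [w = z / sqrt n].  Since [E] is additive under Boolean convolution and
   [E_{l mu}(z) = l E_mu(z / l)], the difference of self-energies at [1 / z] is
   [sqrt n (E_mu(1/w) - w)], and [w] stays in the cone.  So everything reduces
   to [E_mu(1/w) = w + O(|w|^p)] on the cone (p = 2, resp. 3), which follows
   from the moment expansion of [G_mu(1/w)], whose remainder is controlled
   because [|Im (1/w)|] is comparable to [1 / |w|], together with a lower bound
   of order [|w|] for [|G_mu(1/w)|].

   For weak convergence no tightness or inversion argument is needed: closeness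
   of self-energies gives convergence of [G] at two points [i x], [i y], hence of
   the integrals of [1 / (t^2 + x^2)], [1 / (t^2 + y^2)] and [t / (t^2 + y^2)].
   A combination of the first two and [1] is
   [(t^2 - 1)^2 / ((t^2 + x^2) (t^2 + y^2))], which penalizes mass away from
   [1] and [-1]; the third, being odd, separates these two points. *)
Require Import Defs.
From mathcomp Require Import all_boot all_order all_algebra.
From mathcomp Require Import all_classical all_reals all_analysis.
From mathcomp Require Import complex measurable_realfun ring lra.

Set Implicit Arguments.
Unset Strict Implicit.
Unset Printing Implicit Defensive.

Import Order.TTheory GRing.Theory Num.Theory.
Import numFieldNormedType.Exports.
Import ComplexField.Normc.

Local Open Scope classical_set_scope.
Local Open Scope ring_scope.
Local Open Scope complex_scope.

(** * Modulus, imaginary part and resolvent on [R[i]] *)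

Section normc.
Context {R : rcfType}.
Implicit Types z w : R[i].

Lemma normc_ge0 z : 0 <= normc z.
Proof. by case: z => a b /=; rewrite sqrtr_ge0. Qed.

Lemma normc_gt0 z : (0 < normc z) = (z != 0).
Proof.
rewrite lt_neqAle normc_ge0 andbT eq_sym; congr negb.
by apply/eqP/eqP => [/eq0_normc //|->]; rewrite normc0.
Qed.

Lemma normcD_le z w : normc (z + w) <= normc z + normc w.
Proof. exact: le_normcD. Qed.

Lemma normcB_le z w : normc (z - w) <= normc z + normc w.
Proof. by rewrite -(normcN w) normcD_le. Qed.

Lemma normcX z n : normc (z ^+ n) = normc z ^+ n.
Proof.
elim: n => [|n IHn]; first by rewrite !expr0 normc1.
by rewrite !exprS normcM IHn.
Qed.

Lemma sqr_normcE z : normc z ^+ 2 = complex.Re z ^+ 2 + complex.Im z ^+ 2.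
Proof. by case: z => a b /=; rewrite sqr_sqrtr// addr_ge0 ?sqr_ge0. Qed.

Lemma normc_real (x : R) : normc x%:C = `|x|.
Proof. by rewrite /= expr0n addr0 sqrtr_sqr. Qed.

Lemma Re_le_normc z : `|complex.Re z| <= normc z.
Proof. by case: z => a b /=; rewrite -sqrtr_sqr ler_wsqrtr// lerDl sqr_ge0. Qed.

Lemma Im_le_normc z : `|complex.Im z| <= normc z.
Proof. by case: z => a b /=; rewrite -sqrtr_sqr ler_wsqrtr// lerDr sqr_ge0. Qed.

Lemma normc_le_ReIm z : normc z <= `|complex.Re z| + `|complex.Im z|.
Proof.
rewrite -ler_sqr ?nnegrE ?normc_ge0 ?addr_ge0// sqr_normcE sqrrD.
by rewrite !real_normK ?num_real// addrAC lerDl mulrn_wge0// mulr_ge0.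
Qed.

Lemma Im_neq0 z : complex.Im z != 0 -> z != 0.
Proof. by apply: contraNneq => ->. Qed.

Lemma Im_inv_neq0 z : complex.Im z != 0 -> complex.Im (1 / z) != 0.
Proof.
move=> z0; rewrite mul1r; case: z z0 => a b /= b0.
rewrite oppr_eq0 mulf_neq0// invr_eq0 gt_eqF// ltr_wpDl ?sqr_ge0//.
by rewrite lt_neqAle eq_sym sqrf_eq0 b0 sqr_ge0.
Qed.

Lemma subr_real_neq0 z (t : R) : complex.Im z != 0 -> z - t%:C != 0.
Proof. by case: z => a b /= b0; apply: Im_neq0; rewrite /= subr0. Qed.

Lemma Im_le_normc_subr z (t : R) : `|complex.Im z| <= normc (z - t%:C).
Proof. by apply: le_trans (Im_le_normc _); case: z => a b /=; rewrite subr0. Qed.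

(** For real t, z - t and z share their imaginary part, which bounds |z - t| from below. The bound
    is uniform in t, so the resolvent is integrable against every probability measure. *)
Lemma normc_resolvent_le z (t : R) : complex.Im z != 0 ->
  normc (1 / (z - t%:C)) <= `|complex.Im z|^-1.
Proof.
move=> z0; rewrite mul1r normcV lef_pV2 ?posrE ?normr_gt0 ?normc_gt0//.
- exact: Im_le_normc_subr.
- exact: subr_real_neq0.
Qed.

Lemma resolvent_ReIm z (t : R) : complex.Im z != 0 ->
  1 / (z - t%:C) =
  ((complex.Re z - t) / ((complex.Re z - t) ^+ 2 + complex.Im z ^+ 2)) +i*
  (- (complex.Im z / ((complex.Re z - t) ^+ 2 + complex.Im z ^+ 2))).
Proof.
case: z => a b b0; rewrite mul1r.
have -> : (a +i* b) - t%:C = (a - t) +i* b.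
  by apply/eqP; rewrite eq_complex /= subr0 !eqxx.
by [].
Qed.

End normc.

(** * Componentwise integration of complex-valued functions *)

Section Cintegral.
Context {R : realType} (mu : prob R).
Implicit Types (f g : R -> R) (F G : R -> R[i]).

Lemma continuous_bounded_integrable f (M : R) :
  continuous f -> (forall t, `|f t| <= M) -> mu.-integrable setT (EFin \o f).
Proof.
move=> cf fM; apply: measurable_bounded_integrable => //.
- by apply: le_lt_trans (ltry 1); exact: (probability_le1 mu).
- exact: continuous_measurable_fun.
- exists M; split; first exact: num_real.
  by move=> x Mx t _; exact: le_trans (fM t) (ltW Mx).
Qed.

(** This has the shape of [cauchy_transform], which thus becomes a [Cintegral] by mere
    conversion. *)
Definition Cintegral F : R[i] :=
  (\int[mu]_t complex.Re (F t)) +i* (\int[mu]_t complex.Im (F t)).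

Definition Cintegrable F : Prop :=
  mu.-integrable setT (EFin \o (fun t => complex.Re (F t))) /\
  mu.-integrable setT (EFin \o (fun t => complex.Im (F t))).

Lemma eq_Cintegral F G : F =1 G -> Cintegral F = Cintegral G.
Proof. by move=> /funext ->. Qed.

Lemma integrable_scale (k : R) f :
  mu.-integrable setT (EFin \o f) ->
  mu.-integrable setT (EFin \o (fun t => k * f t)).
Proof. by move=> /(integrableZl measurableT k). Qed.

Lemma integrable_add f g :
  mu.-integrable setT (EFin \o f) -> mu.-integrable setT (EFin \o g) ->
  mu.-integrable setT (EFin \o (fun t => f t + g t)).
Proof. by move=> fi gi; exact: (integrableD measurableT fi gi). Qed.

Lemma CintegrableZ (c : R[i]) F : Cintegrable F -> Cintegrable (fun t => c * F t).
Proof.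
case: c => a b [Fr Fi]; split.
- rewrite (_ : (fun t => _) =
    (fun t => a * complex.Re (F t) + (- b) * complex.Im (F t))); last first.
    by apply/funext => t; case: (F t) => x y /=; rewrite mulNr.
  by apply: integrable_add; exact: integrable_scale.
- rewrite (_ : (fun t => _) =
    (fun t => a * complex.Im (F t) + b * complex.Re (F t))); last first.
    by apply/funext => t; case: (F t) => x y /=.
  by apply: integrable_add; exact: integrable_scale.
Qed.

Lemma CintegralZ (c : R[i]) F : Cintegrable F ->
  Cintegral (fun t => c * F t) = c * Cintegral F.
Proof.
case: c => a b [Fr Fi]; rewrite /Cintegral.
have -> : (fun t => complex.Re ((a +i* b) * F t)) =
    (fun t => a * complex.Re (F t) + (- b) * complex.Im (F t)).
  by apply/funext => t; case: (F t) => x y /=; rewrite mulNr.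
have -> : (fun t => complex.Im ((a +i* b) * F t)) =
    (fun t => a * complex.Im (F t) + b * complex.Re (F t)).
  by apply/funext => t; case: (F t) => x y /=.
rewrite !RintegralD//; try exact: integrable_scale.
rewrite !RintegralZl//=.
by rewrite [RHS]/= mulNr.
Qed.

Lemma CintegrableD F G : Cintegrable F -> Cintegrable G ->
  Cintegrable (fun t => F t + G t).
Proof.
move=> [Fr Fi] [Gr Gi]; split.
- rewrite (_ : (fun t => _) =
    (fun t => complex.Re (F t) + complex.Re (G t))); first exact: integrable_add.
  by apply/funext => t; case: (F t) (G t) => x y [].
- rewrite (_ : (fun t => _) =
    (fun t => complex.Im (F t) + complex.Im (G t))); first exact: integrable_add.
  by apply/funext => t; case: (F t) (G t) => x y [].
Qed.

Lemma CintegralD F G : Cintegrable F -> Cintegrable G ->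
  Cintegral (fun t => F t + G t) = Cintegral F + Cintegral G.
Proof.
move=> [Fr Fi] [Gr Gi]; rewrite /Cintegral.
have -> : (fun t => complex.Re (F t + G t)) =
    (fun t => complex.Re (F t) + complex.Re (G t)).
  by apply/funext => t; case: (F t) (G t) => x y [].
have -> : (fun t => complex.Im (F t + G t)) =
    (fun t => complex.Im (F t) + complex.Im (G t)).
  by apply/funext => t; case: (F t) (G t) => x y [].
by rewrite !RintegralD.
Qed.

Lemma Cintegrable_real f :
  mu.-integrable setT (EFin \o f) -> Cintegrable (fun t => (f t)%:C).
Proof. by move=> fi; split => //=; exact: integrable0. Qed.

Lemma Cintegral_real f : Cintegral (fun t => (f t)%:C) = (\int[mu]_t f t)%:C.
Proof. by rewrite /Cintegral /= Rintegral_cst// mul0r. Qed.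

Lemma Cintegrable0 : Cintegrable (fun=> 0).
Proof. by split; exact: integrable0. Qed.

Lemma Cintegral0 : Cintegral (fun=> 0) = 0.
Proof. by rewrite /Cintegral/= !Rintegral_cst// mul0r. Qed.

Lemma Cintegrable_sum n (F : nat -> R -> R[i]) :
  (forall k, (k < n)%N -> Cintegrable (F k)) ->
  Cintegrable (fun t => \sum_(k < n) F k t).
Proof.
elim: n => [_|n IHn Fi].
  rewrite (_ : (fun t => _) = (fun=> 0)); first exact: Cintegrable0.
  by apply/funext => t; rewrite big_ord0.
rewrite (_ : (fun t => _) = (fun t => \sum_(k < n) F k t + F n t)); last first.
  by apply/funext => t; rewrite big_ord_recr.
by apply: CintegrableD; [apply: IHn => k kn; apply/Fi/ltnW|exact: Fi].
Qed.

Lemma Cintegral_sum n (F : nat -> R -> R[i]) :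
  (forall k, (k < n)%N -> Cintegrable (F k)) ->
  Cintegral (fun t => \sum_(k < n) F k t) = \sum_(k < n) Cintegral (F k).
Proof.
elim: n => [_|n IHn Fi].
  rewrite big_ord0 -[RHS]Cintegral0; apply: eq_Cintegral => t.
  by rewrite big_ord0.
rewrite big_ord_recr/= -IHn; last by move=> k kn; apply/Fi/ltnW.
rewrite -CintegralD; last 2 first.
- by apply: Cintegrable_sum => k kn; apply/Fi/ltnW.
- exact: Fi.
by apply: eq_Cintegral => t; rewrite big_ord_recr.
Qed.

Lemma normr_Rintegral_le f g :
  mu.-integrable setT (EFin \o f) -> mu.-integrable setT (EFin \o g) ->
  (forall t, `|f t| <= g t) -> `|\int[mu]_t f t| <= \int[mu]_t g t.
Proof.
move=> fi gi fg; apply: le_trans (le_normr_Rintegral _ _) _ => //.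
by apply: le_Rintegral => //; exact: integrable_norm.
Qed.

(** The factor 2 comes from estimating the real and imaginary parts separately; it is absorbed in
    later constants. *)
Lemma normc_Cintegral_le F g : Cintegrable F ->
  mu.-integrable setT (EFin \o g) -> (forall t, normc (F t) <= g t) ->
  normc (Cintegral F) <= 2 * \int[mu]_t g t.
Proof.
move=> [Fr Fi] gi Fg; rewrite (le_trans (normc_le_ReIm _))//= mulr2n mulrDl mul1r.
apply: lerD; apply: normr_Rintegral_le => // t; apply: le_trans (Fg t).
- exact: Re_le_normc.
- exact: Im_le_normc.
Qed.

End Cintegral.

(** * Integrability of the resolvent *)

Section cauchy_transform.
Context {R : realType} (mu : prob R).
Implicit Types z w : R[i].

Lemma resolvent_den_neq0 (x y t : R) : y != 0 -> (x - t) ^+ 2 + y ^+ 2 != 0.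
Proof.
by move=> y0; rewrite gt_eqF// ltr_wpDl ?sqr_ge0// lt_neqAle eq_sym sqrf_eq0 y0 sqr_ge0.
Qed.

Lemma continuous_resolvent_den (x y : R) :
  continuous (fun t : R => (x - t) ^+ 2 + y ^+ 2).
Proof.
move=> t; apply: cvgD; last exact: cvg_cst.
apply: (@cvg_comp _ _ _ (fun t => x - t) (fun u => u ^+ 2)).
  by apply: cvgB; [exact: cvg_cst|exact: cvg_id].
exact: exprn_continuous.
Qed.

Lemma Cintegrable_resolvent z : complex.Im z != 0 ->
  Cintegrable mu (fun t => 1 / (z - t%:C)).
Proof.
move=> z0; split; apply: (@continuous_bounded_integrable _ _ _ `|complex.Im z|^-1).
- rewrite (_ : (fun t => _) = (fun t => (complex.Re z - t) /
    ((complex.Re z - t) ^+ 2 + complex.Im z ^+ 2))); last first.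
    by apply/funext => t; rewrite resolvent_ReIm.
  move=> t; apply: cvgM; first by apply: cvgB; [exact: cvg_cst|exact: cvg_id].
  by apply: cvgV; [exact: resolvent_den_neq0|exact: continuous_resolvent_den].
- by move=> t; rewrite (le_trans (Re_le_normc _)) ?normc_resolvent_le.
- rewrite (_ : (fun t => _) = (fun t => - (complex.Im z /
    ((complex.Re z - t) ^+ 2 + complex.Im z ^+ 2)))); last first.
    by apply/funext => t; rewrite resolvent_ReIm.
  move=> t; apply: cvgN; apply: cvgM; first exact: cvg_cst.
  by apply: cvgV; [exact: resolvent_den_neq0|exact: continuous_resolvent_den].
- by move=> t; rewrite (le_trans (Im_le_normc _)) ?normc_resolvent_le.
Qed.

Lemma cauchy_transformE z :
  cauchy_transform mu z = Cintegral mu (fun t => 1 / (z - t%:C)).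
Proof. by []. Qed.

End cauchy_transform.

(** * Moment expansion of the Cauchy transform and a lower bound for it *)

Section estimates.
Context {R : realType} (mu : prob R).
Implicit Types z w : R[i].

(** Finite geometric series with exact remainder: each round replaces the resolvent in the remainder
    by w plus w t times itself. *)
Lemma resolvent_expansion (w : R[i]) (t : R) N : complex.Im w != 0 ->
  1 / (1 / w - t%:C) = \sum_(k < N) w ^+ k.+1 * (t ^+ k)%:C
    + w ^+ N * (t ^+ N)%:C * (1 / (1 / w - t%:C)).
Proof.
move=> w0; have wt0 := subr_real_neq0 t (Im_inv_neq0 w0).
elim: N => [|N IHN]; first by rewrite big_ord0 !expr0 !mul1r add0r.
rewrite [LHS]IHN big_ord_recr/= -addrA; congr (_ + _).
have E : 1 / (1 / w - t%:C) = w + w * t%:C * (1 / (1 / w - t%:C)).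
  apply: (mulIf wt0); rewrite mulrDl -(mulrA (w * _)) divfK// mulr1.
  by rewrite mulrBr mul1r mulfV ?Im_neq0// subrK.
by rewrite {1}E mulrDr !exprSr rmorphM/=; ring.
Qed.

(** Integrating the geometric expansion turns powers of t into moments; the resolvent left in the
    remainder is at most 1 / |Im (1/w)|. *)
Lemma cauchy_transform_expansion w N : complex.Im w != 0 ->
  (forall k, (k <= N)%N -> finite_moment k mu) ->
  normc (cauchy_transform mu (1 / w)
         - \sum_(k < N) w ^+ k.+1 * (moment k mu)%:C)
  <= 2 * (normc w ^+ N / `|complex.Im (1 / w)| * \int[mu]_t (`|t| ^+ N)).
Proof.
move=> w0 muN; have z0 := Im_inv_neq0 w0.
have ki k : (k < N)%N -> Cintegrable mu (fun t => w ^+ k.+1 * (t ^+ k)%:C).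
  by move=> kN; apply/CintegrableZ/Cintegrable_real/muN/ltnW.
have -> : \sum_(k < N) w ^+ k.+1 * (moment k mu)%:C =
    Cintegral mu (fun t => \sum_(k < N) w ^+ k.+1 * (t ^+ k)%:C).
  rewrite (@Cintegral_sum _ mu _ (fun k t => w ^+ k.+1 * (t ^+ k)%:C))//.
  apply: eq_bigr => k _; rewrite CintegralZ ?Cintegral_real//.
  by apply: Cintegrable_real; apply: muN; exact: ltnW.
have si := Cintegrable_sum ki.
have nsi := CintegrableZ (-1) si.
have ri := Cintegrable_resolvent mu z0.
rewrite -mulN1r -(CintegralZ _ si) cauchy_transformE -(CintegralD ri nsi).
have ai : mu.-integrable setT (EFin \o (fun t : R => `|t| ^+ N)).
  rewrite (_ : _ \o _ = EFin \o (Num.norm \o (fun t : R => t ^+ N))); last first.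
    by apply/funext => t /=; rewrite normrX.
  by apply: integrable_norm; exact: muN.
rewrite -(RintegralZl _ _ ai)//.
apply: normc_Cintegral_le; [exact: CintegrableD|exact: integrable_scale|].
(* Pointwise, subtracting the partial sum leaves exactly the remainder of the expansion. *)
move=> t; rewrite {1}(resolvent_expansion t N w0) mulN1r addrAC subrr add0r.
rewrite !normcM normcX normc_real normrX -mulrA [leRHS]mulrAC -[leRHS]mulrA.
rewrite ler_wpM2l ?exprn_ge0 ?normc_ge0// ler_wpM2l ?exprn_ge0//.
rewrite -normcM; exact: normc_resolvent_le.
Qed.

Hypotheses (m0 : finite_moment 0 mu) (m1 : finite_moment 1 mu)
  (m2 : finite_moment 2 mu) (mean0 : moment 1 mu = 0) (var1 : moment 2 mu = 1).

Lemma moment0 : moment 0 mu = 1.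
Proof.
rewrite /moment; under eq_Rintegral do rewrite expr0.
rewrite Rintegral_cst// mul1r.
by rewrite (_ : fine _ = fine 1%E)//; congr fine; exact: (probability_setT mu).
Qed.

(** Prepares the integration of a minorant of 1 / |z - t|^2 that is quadratic in t: mass 1, mean 0
    and variance 1 determine its mean. *)
Lemma Rintegral_quadratic (a b c : R) :
  \int[mu]_t (a + b * t + c * t ^+ 2) = a + c /\
  mu.-integrable setT (EFin \o (fun t : R => a + b * t + c * t ^+ 2)).
Proof.
have i0 : mu.-integrable setT (EFin \o (fun t : R => a * t ^+ 0)).
  exact: integrable_scale.
have i1 : mu.-integrable setT (EFin \o (fun t : R => b * t ^+ 1)).
  exact: integrable_scale.
have i2 : mu.-integrable setT (EFin \o (fun t : R => c * t ^+ 2)).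
  exact: integrable_scale.
have -> : (fun t : R => a + b * t + c * t ^+ 2) =
    (fun t => a * t ^+ 0 + b * t ^+ 1 + c * t ^+ 2).
  by apply/funext => t; rewrite expr0 expr1 mulr1.
have i01 := integrable_add i0 i1; split; last exact: integrable_add.
rewrite !RintegralD// !RintegralZl//.
by rewrite -/(moment 0 mu) -/(moment 1 mu) -/(moment 2 mu) moment0 mean0 var1; ring.
Qed.

(* Jensen: [|z - t|^2] has mean [|z|^2 + 1], and [1 / A >= 2 / a - A / a^2]. *)
Lemma Im_cauchy_transform_ge z : complex.Im z != 0 ->
  `|complex.Im z| / (normc z ^+ 2 + 1) <= `|complex.Im (cauchy_transform mu z)|.
Proof.
move=> z0; rewrite sqr_normcE /=.
under eq_Rintegral do rewrite resolvent_ReIm//=.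
set x := complex.Re z; set y := complex.Im z; rewrite -/y in z0.
have y2 : 0 < y ^+ 2 by rewrite lt_neqAle eq_sym sqrf_eq0 z0 sqr_ge0.
set a := _ + 1; have a0 : 0 < a by rewrite /a; have := sqr_ge0 x; lra.
have den0 t : 0 < (x - t) ^+ 2 + y ^+ 2 by rewrite ltr_wpDl ?sqr_ge0.
have Ai : mu.-integrable setT (EFin \o (fun t : R => ((x - t) ^+ 2 + y ^+ 2)^-1)).
  apply: (@continuous_bounded_integrable _ _ _ (y ^+ 2)^-1).
  - move=> t; apply: cvgV; [exact: resolvent_den_neq0|].
    exact: continuous_resolvent_den.
  - move=> t; rewrite normfV (gtr0_norm (den0 t)) lef_pV2 ?posrE//.
    by rewrite lerDr sqr_ge0.
have -> : \int[mu]_t (- (y / ((x - t) ^+ 2 + y ^+ 2))) =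
    - y * \int[mu]_t (((x - t) ^+ 2 + y ^+ 2)^-1).
  by rewrite -RintegralZl//; apply: eq_Rintegral => t _; rewrite mulNr.
rewrite normrM normrN ler_wpM2l//; apply: le_trans (ler_norm _).
(* The coefficients come from expanding 2/a - A/a^2 in powers of t, with A = (x - t)^2 + y^2. Since
   a = x^2 + y^2 + 1 is the mean of A, this minorant has mean 1/a. *)
have [qE qi] := Rintegral_quadratic (2 / a - (x ^+ 2 + y ^+ 2) / a ^+ 2)
  (2 * x / a ^+ 2) (- (a ^+ 2)^-1).
have -> : a^-1 = 2 / a - (x ^+ 2 + y ^+ 2) / a ^+ 2 - (a ^+ 2)^-1.
  by rewrite (_ : x ^+ 2 + y ^+ 2 = a - 1) ?/a ?addrK//; field; rewrite gt_eqF.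
rewrite -qE; apply: le_Rintegral => // t _.
set A := (x - t) ^+ 2 + y ^+ 2.
rewrite [X in X <= _](_ : _ = 2 / a - A / a ^+ 2); last first.
  by rewrite /A; field; rewrite gt_eqF.
rewrite -subr_ge0 (_ : _ - _ = (A - a) ^+ 2 / (A * a ^+ 2)); last first.
  by field; rewrite !gt_eqF//; exact: den0.
by rewrite divr_ge0 ?sqr_ge0// mulr_ge0 ?sqr_ge0// ltW//; exact: den0.
Qed.

End estimates.

(** * Expansion of E(1/w) on the truncated cone *)

Section self_energy.
Context {R : realType}.
Implicit Types (mu nu : prob R) (z w : R[i]).

Lemma truncated_cone_Im (eps : R) w : truncated_cone eps eps w ->
  complex.Im w != 0.
Proof. by move=> [w0 _ _]; rewrite lt_eqF. Qed.

Lemma truncated_cone_normc (eps : R) w : truncated_cone eps eps w ->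
  normc w <= (1 + eps) * `|complex.Im w|.
Proof.
move=> [w0 wr _]; apply: le_trans (normc_le_ReIm w) _.
by rewrite (ltr0_norm w0); lra.
Qed.

Lemma truncated_cone_bounded (eps : R) w : 0 < eps ->
  truncated_cone eps eps w -> normc w <= (1 + eps) * eps.
Proof.
move=> e0 we; apply: le_trans (truncated_cone_normc we) _.
case: we => w0 _ we; rewrite ler_pM2l ?ltr0_norm//; lra.
Qed.

(** Contraction towards 0 preserves the slope condition and relaxes the depth condition; this keeps
    z / sqrt n in the cone. *)
Lemma truncated_cone_scale (eps s : R) w : 0 < s -> s <= 1 ->
  truncated_cone eps eps w -> truncated_cone eps eps (s%:C * w).
Proof.
case: w => a b s0 s1 [/= b0 ab eb].
rewrite /truncated_cone/= !mul0r subr0 addr0; split.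
- by rewrite pmulr_rlt0.
- by rewrite normrM (gtr0_norm s0) mulrCA ltr_pM2l.
- by apply: lt_le_trans eb _; nra.
Qed.

Lemma normr_Im_inv w : `|complex.Im (1 / w)| = `|complex.Im w| / normc w ^+ 2.
Proof.
rewrite mul1r sqr_normcE; case: w => a b /=.
by rewrite normrN normrM normfV [X in _ / X]ger0_norm ?addr_ge0 ?sqr_ge0.
Qed.

(** |Im (1/w)| equals |Im w| / |w|^2, and the cone makes |Im w| comparable to |w|. Dividing by |Im
    (1/w)| thus gains one power of |w|. *)
Lemma normc_Im_inv_ge (eps : R) w : truncated_cone eps eps w ->
  `|complex.Im (1 / w)|^-1 <= (1 + eps) * normc w.
Proof.
move=> we; have w0 := truncated_cone_Im we.
have nw0 : 0 < normc w by rewrite normc_gt0 Im_neq0.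
rewrite normr_Im_inv invf_div ler_pdivrMr ?normr_gt0// expr2 mulrAC ler_pM2r//.
exact: truncated_cone_normc.
Qed.

Lemma moment_expansion_cone (eps : R) mu N : 0 < eps ->
  (forall k, (k <= N)%N -> finite_moment k mu) ->
  exists2 K : R, 0 < K & forall w, truncated_cone eps eps w ->
    normc (cauchy_transform mu (1 / w)
           - \sum_(k < N) w ^+ k.+1 * (moment k mu)%:C) <= K * normc w ^+ N.+1.
Proof.
move=> e0 muN; set M := \int[mu]_t (`|t| ^+ N).
have M0 : 0 <= M by apply: Rintegral_ge0 => t _; rewrite exprn_ge0.
(* Using [M + 1] keeps the constant positive even when M = 0. *)
exists (2 * ((1 + eps) * (M + 1))); first by rewrite !mulr_gt0//; lra.
move=> w we; apply: le_trans (cauchy_transform_expansion _ muN) _.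
  exact: truncated_cone_Im we.
have Iw := normc_Im_inv_ge we; have nw := normc_ge0 w; rewrite -/M.
rewrite (_ : _ * _ ^+ N.+1 =
    2 * (normc w ^+ N * ((1 + eps) * normc w) * (M + 1))); last first.
  by rewrite exprSr; ring.
rewrite ler_wpM2l// ler_pM// ?mulr_ge0 ?invr_ge0 ?exprn_ge0//; last by lra.
by rewrite ler_wpM2l ?exprn_ge0.
Qed.

(* With [g = G(1/w)]: [E(1/w) - w = ((g - w - w^3) - w^2 (g - w)) / (w g)]. *)
Lemma self_energy_estimate (eps : R) mu (p : nat) (K : R) : 0 < eps -> 0 < K ->
  (p <= 3)%N -> standardized 2 mu ->
  (forall w, truncated_cone eps eps w ->
    normc (cauchy_transform mu (1 / w) - w - w ^+ 3) <= K * normc w ^+ p.+2) ->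
  exists2 C : R, 0 < C & forall w, truncated_cone eps eps w ->
    normc (self_energy mu (1 / w) - w) <= C * normc w ^+ p.
Proof.
move=> e0 K0 p3 [fm mean0 var1] gK.
(* [B] bounds |w| on the cone, and [c] is chosen so that |g| >= |w| / c. *)
pose B := (1 + eps) * eps; have B0 : 0 < B by rewrite mulr_gt0//; lra.
pose c := (1 + eps) * (1 + B ^+ 2).
have c0 : 0 < c by rewrite mulr_gt0//; have := sqr_ge0 B; lra.
(* [L] bounds the numerator by L |w|^(p+2): [K] for g - w - w^3, and for w^2 (g - w) the terms |w|^5
   = |w|^(3-p) |w|^(p+2) and K |w|^2 |w|^(p+2). This is where p <= 3 enters. *)
pose L := K + (B ^+ (3 - p) + K * B ^+ 2).
have L0 : 0 < L.
  apply: addr_gt0 => //; apply: addr_gt0; first exact: exprn_gt0.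
  by rewrite mulr_gt0 ?exprn_gt0.
exists (L * c); first by rewrite mulr_gt0.
move=> w we; have := gK _ we; set g := cauchy_transform mu (1 / w) => gw.
have Iw0 := truncated_cone_Im we; have w0 := Im_neq0 Iw0.
have Bw := truncated_cone_bounded e0 we; rewrite -/B in Bw.
have nw0 : 0 < normc w by rewrite normc_gt0.
(* At 1/w the lower bound on |Im G| reads |Im w| / (1 + |w|^2), and |Im w| >= |w| / (1 + eps) on the
   cone. *)
have glow : normc w / c <= normc g.
  apply: le_trans (Im_le_normc g).
  apply: le_trans (Im_cauchy_transform_ge (fm 0%N isT) (fm 1%N isT)
    (fm 2%N isT) mean0 var1 (Im_inv_neq0 Iw0)).
  rewrite normr_Im_inv mul1r normcV.
  rewrite (_ : _ / (_ + 1) = `|complex.Im w| / (1 + normc w ^+ 2)); last first.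
    by field; rewrite !gt_eqF//; have := sqr_ge0 (normc w); lra.
  rewrite ler_pdivrMr// mulrAC ler_pdivlMr; last first.
    by have := sqr_ge0 (normc w); lra.
  rewrite /c mulrA ler_pM ?normc_ge0//.
  - by have := sqr_ge0 (normc w); lra.
  - by rewrite mulrC; exact: truncated_cone_normc.
  - by rewrite lerD2l lerXn2r ?nnegrE ?normc_ge0 ?(ltW B0).
have g0 : 0 < normc g by apply: lt_le_trans glow; rewrite divr_gt0.
have gn0 : g != 0 by rewrite -normc_gt0.
have -> : self_energy mu (1 / w) - w =
    ((g - w - w ^+ 3) - w ^+ 2 * (g - w)) / (w * g).
  by rewrite /self_energy -/g; field; rewrite w0 gn0.
rewrite !(normcM, normcV) ler_pdivrMr ?mulr_gt0//.
have gw1 : normc (g - w) <= K * normc w ^+ p.+2 + normc w ^+ 3.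
  rewrite -[g - w](subrK (w ^+ 3)); apply: le_trans (normcD_le _ _) _.
  by rewrite normcX lerD2r.
apply: le_trans (normcB_le _ _) _; rewrite normcM normcX.
(* The denominator satisfies |w g| >= |w|^2 / c, which lowers the exponent p + 2 to p. *)
apply: (@le_trans _ _ (L * normc w ^+ p.+2)); last first.
  rewrite (_ : L * _ = L * c * normc w ^+ p * (normc w * (normc w / c))).
    apply: ler_wpM2l; last by rewrite ler_pM2l.
    by rewrite (mulr_ge0 (ltW (mulr_gt0 L0 c0)))// exprn_ge0// normc_ge0.
  by rewrite !exprSr; field; rewrite gt_eqF.
rewrite /L mulrDl; apply: lerD => //.
apply: le_trans (ler_wpM2l (sqr_ge0 _) gw1) _.
rewrite mulrDr addrC mulrDl; apply: lerD.
  rewrite -exprD (_ : 2 + 3 = (3 - p) + p.+2)%N; last first.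
    by rewrite -(addn2 p) addnA subnK.
  rewrite exprD ler_wpM2r ?exprn_ge0 ?normc_ge0// lerXn2r// ?nnegrE ?normc_ge0//.
  exact: ltW.
rewrite mulrCA mulrA ler_wpM2r ?exprn_ge0 ?normc_ge0// ler_pM2l//.
by rewrite lerXn2r ?nnegrE ?normc_ge0 ?(ltW B0).
Qed.

End self_energy.

(** * Self-energies of dilations, Boolean powers and [rho_b]; the rate of convergence *)

Section dilation_bernoulli.
Context {R : realType}.
Implicit Types (mu nu : prob R) (z w : R[i]).

Lemma Rintegral_dilate (l : R) mu (f : R -> R) :
  measurable_fun setT (f : measurableTypeR R -> R) ->
  mu.-integrable setT (EFin \o (fun t : R => f (l * t))) ->
  \int[dilate l mu]_t f t = \int[mu]_t f (l * t).
Proof.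
move=> mf fi; congr fine.
by rewrite [LHS](@integral_distribution _ _ _ _ _ mu (scaling l) (EFin \o f))//;
  exact/measurable_EFinP.
Qed.

(** Homogeneity of the resolvent: 1 / (z - l t) = l^-1 / (l^-1 z - t). *)
Lemma cauchy_transform_dilate (l : R) mu z : 0 < l -> complex.Im z != 0 ->
  cauchy_transform (dilate l mu) z =
  (l^-1)%:C * cauchy_transform mu ((l^-1)%:C * z).
Proof.
move=> l0 z0; have lz0 : complex.Im ((l^-1)%:C * z) != 0.
  by case: z z0 => a b /= b0; rewrite mul0r addr0 mulf_neq0// invr_eq0 gt_eqF.
have lC0 : (l^-1)%:C != 0 :> R[i].
  by apply/eqP => -[] /eqP; rewrite invr_eq0 gt_eqF.
have resE t : 1 / (z - (l * t)%:C) = (l^-1)%:C * (1 / ((l^-1)%:C * z - t%:C)).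
  have -> : z - (l * t)%:C = (l%:C) * ((l^-1)%:C * z - t%:C).
    by rewrite mulrBr mulrA -!rmorphM/= divff ?gt_eqF// mul1r.
  by rewrite !mul1r invfM fmorphV.
have li := CintegrableZ (l^-1)%:C (Cintegrable_resolvent mu lz0).
rewrite !cauchy_transformE -CintegralZ; last exact: Cintegrable_resolvent.
rewrite -(eq_Cintegral mu resE).
have [mr mi] := Cintegrable_resolvent mu z0.
have [lr lim] : Cintegrable mu (fun t => 1 / (z - (l * t)%:C)).
  by rewrite (_ : (fun t => _) = (fun t => (l^-1)%:C * (1 / ((l^-1)%:C * z - t%:C)))) //; apply/funext.
congr (_ +i* _).
- apply: (Rintegral_dilate (f := fun t => complex.Re (1 / (z - t%:C)))) => //.
  by apply/measurable_EFinP; exact: measurable_int mr.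
- apply: (Rintegral_dilate (f := fun t => complex.Im (1 / (z - t%:C)))) => //.
  by apply/measurable_EFinP; exact: measurable_int mi.
Qed.

Lemma self_energy_dilate (l : R) mu z : 0 < l -> complex.Im z != 0 ->
  self_energy (dilate l mu) z = l%:C * self_energy mu ((l^-1)%:C * z).
Proof.
move=> l0 z0; rewrite /self_energy cauchy_transform_dilate// mulrBr mulrA -rmorphM/=.
by rewrite divff ?gt_eqF// mul1r !mul1r invfM -fmorphV invrK.
Qed.

Lemma self_energy_bool_pow mu nu n z : is_bool_pow mu n nu ->
  complex.Im z != 0 -> self_energy nu z = n%:R * self_energy mu z.
Proof.
move=> pow z0; elim: pow => [|{}n {}nu rho _ IHn conv]; first by rewrite mul1r.
by rewrite conv// IHn -natr1 mulrDl mul1r.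
Qed.

(** Nonnegative integrands are treated first, by additivity in the measure; then f is split into its
    positive and negative parts. *)
Lemma Rintegral_rho_b (f : R -> R) :
  measurable_fun setT (f : measurableTypeR R -> R) ->
  \int[rho_b]_t f t = (f 1 + f (- 1)) / 2.
Proof.
move=> mf.
have ge0E (g : measurableTypeR R -> \bar R) : measurable_fun setT g ->
    (forall t, 0 <= g t)%E ->
    (\int[rho_b]_t g t = (2^-1)%:E * g 1%R + (2^-1)%:E * g (- 1)%R)%E.
  move=> mg g0; rewrite ge0_integral_measure_add// !ge0_integral_mscale//.
  by rewrite !integral_dirac// !diracE !in_setT !mul1e.
have mF : measurable_fun setT (EFin \o f) by exact/measurable_EFinP.
rewrite /Rintegral integralE !ge0E//; last 2 first.
- exact: measurable_funeneg.
- exact: measurable_funepos.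
rewrite !funeposE !funenegE /= -!EFin_max -!EFinM -!EFinD /=.
(* The four cases decide the maxima defining the two parts of f at 1 and at -1. *)
rewrite !maxEle; do 4! [case: ifPn => ?]; lra.
Qed.

(** Here G(z) = z / (z^2 - 1), so z - 1/G(z) = 1/z. *)
Lemma self_energy_rho_b z : complex.Im z != 0 -> self_energy rho_b z = 1 / z.
Proof.
move=> z0; rewrite /self_energy.
have [mr mi] := Cintegrable_resolvent rho_b z0.
have z1 := subr_real_neq0 1 z0; have z2 := subr_real_neq0 (-1) z0.
have zn := Im_neq0 z0.
have -> : cauchy_transform rho_b z =
    (1 / (z - 1%:C) + 1 / (z - (-1)%:C)) * (2^-1)%:C.
  rewrite /cauchy_transform.
  rewrite (Rintegral_rho_b (f := fun t => complex.Re (1 / (z - t%:C)))); last first.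
    by apply/measurable_EFinP; exact: measurable_int mr.
  rewrite (Rintegral_rho_b (f := fun t => complex.Im (1 / (z - t%:C)))); last first.
    by apply/measurable_EFinP; exact: measurable_int mi.
  case: (1 / _) (1 / _) => a b [c d] /=.
  by apply/eqP; rewrite eq_complex /= !mulr0 subr0 add0r !eqxx.
rewrite fmorphV rmorph_nat rmorphN !rmorph1 opprK in z1 z2 *.
(* The remaining side condition is that (z + 1) + (z - 1) = 2 z is nonzero. *)
field; rewrite zn z1 z2 /=.
by rewrite addrACA subrr addr0 -mulr2n mulrn_eq0.
Qed.

(** With s = sqrt n and w = z / s the difference is s (E(1/w) - w), of size at most s C |z /
    s|^(p+1) = C |z|^(p+1) / s^p. *)
Lemma self_energy_clt (eps C : R) mu (p : nat) :
  (forall w, truncated_cone eps eps w ->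
    normc (self_energy mu (1 / w) - w) <= C * normc w ^+ p.+1) ->
  forall n nu, (1 <= n)%N -> is_bool_pow mu n nu ->
  forall z, truncated_cone eps eps z ->
  normc (self_energy (dilate (1 / Num.sqrt n%:R) nu) (1 / z)
         - self_energy rho_b (1 / z)) <= C / Num.sqrt n%:R ^+ p * normc z ^+ p.+1.
Proof.
move=> EC n nu n1 pow z ze; have z0 := truncated_cone_Im ze.
set s := Num.sqrt n%:R.
have s1 : 1 <= s by rewrite -sqrtr1 ler_wsqrtr// ler1n.
have s0 : 0 < s by apply: lt_le_trans s1.
have sn : s ^+ 2 = n%:R by rewrite sqr_sqrtr.
have sz : 0 < s^-1 <= 1 by rewrite invr_gt0 s0 invf_le1.
case/andP: sz => is0 is1; have we := truncated_cone_scale is0 is1 ze.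
have Iz := Im_inv_neq0 z0; have zn := Im_neq0 z0.
have sC0 : s%:C != 0 :> R[i] by apply/eqP => -[] /eqP; rewrite gt_eqF.
rewrite (div1r s) self_energy_rho_b// self_energy_dilate// invrK.
rewrite (self_energy_bool_pow pow); last first.
  move: Iz; case: (1 / z) => a b /= b0.
  by rewrite mul0r addr0 mulf_neq0// gt_eqF.
have -> : s%:C * (1 / z) = 1 / ((s^-1)%:C * z).
  by rewrite !mul1r invfM -fmorphV/= invrK.
(* Uses n / s = s and z = s (z / s). *)
have -> : (s^-1)%:C * (n%:R * self_energy mu (1 / ((s^-1)%:C * z))) - 1 / (1 / z) =
    s%:C * (self_energy mu (1 / ((s^-1)%:C * z)) - (s^-1)%:C * z).
  rewrite mulrA [RHS]mulrBr; congr (_ * _ - _).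
  - by rewrite -(rmorph_nat (real_complex R)) -sn rmorphXn fmorphV/= expr2 mulKf.
  - by rewrite fmorphV/= mulVKf// !mul1r invrK.
rewrite normcM normc_real (gtr0_norm s0).
apply: le_trans (ler_wpM2l (ltW s0) (EC _ we)) _.
rewrite normcM normc_real (gtr0_norm is0).
rewrite le_eqVlt; apply/orP; left; apply/eqP.
rewrite exprMn (exprSr s^-1) exprVn; have := exprn_gt0 p s0.
by set u := s ^+ p => u0; field; rewrite !gt_eqF.
Qed.

Lemma dBool_clt (eps C : R) mu (p : nat) :
  (forall w, truncated_cone eps eps w ->
    normc (self_energy mu (1 / w) - w) <= C * normc w ^+ p.+1) ->
  forall n nu, (1 <= n)%N -> is_bool_pow mu n nu ->
  (dBool eps p.+1 (dilate (1 / Num.sqrt n%:R) nu) rho_b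
    <= (C / Num.sqrt n%:R ^+ p)%:E)%E.
Proof.
move=> EC n nu n1 pow; apply: ge_ereal_sup => _ [z ze <-].
rewrite lee_fin ler_pdivrMr; first exact: (self_energy_clt EC n1 pow ze).
by rewrite exprn_gt0// normc_gt0 Im_neq0// (truncated_cone_Im ze).
Qed.

End dilation_bernoulli.

(** * From self-energies to Cauchy transforms; a criterion for weak convergence to [rho_b] *)

Section weak_convergence.
Context {R : realType}.
Implicit Types (mu nu : prob R) (z w : R[i]).

Lemma Rintegral_prob_cst mu (c : R) : \int[mu]_t c = c.
Proof.
rewrite Rintegral_cst// -[RHS]mulr1; congr (_ * _).
by rewrite -[RHS]/(fine 1%E); congr fine; exact: (probability_setT mu).
Qed.

Lemma integrable_prob_cst mu (c : R) : mu.-integrable setT (EFin \o (fun=> c)).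
Proof.
apply: (@continuous_bounded_integrable _ _ _ `|c|) => // t; exact: cvg_cst.
Qed.

Lemma normc_cauchy_transform_le mu z : complex.Im z != 0 ->
  normc (cauchy_transform mu z) <= 2 / `|complex.Im z|.
Proof.
move=> z0; rewrite -(Rintegral_prob_cst mu `|complex.Im z|^-1).
apply: normc_Cintegral_le; first exact: Cintegrable_resolvent.
- exact: integrable_prob_cst.
- by move=> t; exact: normc_resolvent_le.
Qed.

(* Since [0^-1 = 0], the bound also holds when [g] or [h] vanishes. *)
Lemma normc_sub_le_invB (g h : R[i]) :
  normc (g - h) <= normc (h^-1 - g^-1)
                   * (normc g * normc h + normc g ^+ 2 + normc h ^+ 2).
Proof.
have gn := normc_ge0 g; have hn := normc_ge0 h.
have en := normc_ge0 (h^-1 - g^-1).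
have [->|g0] := eqVneq g 0.
  rewrite invr0 subr0 sub0r normcN normc0 mul0r expr0n/= !add0r.
  rewrite -normcX -normcM; have [->|h0] := eqVneq h 0.
    by rewrite invr0 mul0r normc0.
  by rewrite expr2 mulKf.
have [->|h0] := eqVneq h 0.
  rewrite invr0 subr0 sub0r normcN normc0 mulr0 expr0n/= addr0 add0r.
  by rewrite -normcX -normcM expr2 mulKf.
have -> : g - h = (h^-1 - g^-1) * (g * h) by field; rewrite g0 h0.
by rewrite !normcM ler_wpM2l// -addrA lerDl addr_ge0 ?sqr_ge0.
Qed.

(** The self-energies differ by 1/h - 1/g. Both |g| and |h| are at most 2 / |Im z|, so each of the
    three products in [normc_sub_le_invB] is at most 4 / |Im z|^2, whence 12. *)
Lemma cauchy_transform_lipschitz mu nu z : complex.Im z != 0 ->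
  normc (cauchy_transform mu z - cauchy_transform nu z) <=
  12 / `|complex.Im z| ^+ 2 * normc (self_energy mu z - self_energy nu z).
Proof.
move=> z0; have := normc_cauchy_transform_le mu z0.
have := normc_cauchy_transform_le nu z0; rewrite /self_energy.
set g := cauchy_transform mu z; set h := cauchy_transform nu z => hle gle.
have -> : z - 1 / g - (z - 1 / h) = h^-1 - g^-1 by rewrite !div1r; ring.
set y := `|complex.Im z| in hle gle *; have y0 : 0 < y by rewrite normr_gt0.
apply: le_trans (normc_sub_le_invB g h) _; rewrite mulrC ler_wpM2r ?normc_ge0//.
rewrite (_ : 12 / _ = (2 / y) * (2 / y) + (2 / y) ^+ 2 + (2 / y) ^+ 2); last first.
  by field; rewrite gt_eqF.
have y2 : 0 <= 2 / y by rewrite divr_ge0// ltW.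
by rewrite !lerD// ?ler_pM ?normc_ge0// lerXn2r// nnegrE normc_ge0.
Qed.

Lemma cvg_cauchy_transform (eps C : R) mu (mu_ : nat -> prob R) w : 0 < C ->
  (forall w, truncated_cone eps eps w ->
    normc (self_energy mu (1 / w) - w) <= C * normc w ^+ 2) ->
  (forall n, (1 <= n)%N -> is_bool_pow mu n (mu_ n)) ->
  truncated_cone eps eps w ->
  normc (cauchy_transform (dilate (1 / Num.sqrt n%:R) (mu_ n)) (1 / w)
         - cauchy_transform rho_b (1 / w)) @[n --> \oo] --> 0.
Proof.
move=> C0 EC pow we; have w0 := truncated_cone_Im we.
have iw0 := Im_inv_neq0 w0.
pose K := 12 / `|complex.Im (1 / w)| ^+ 2 * (C * normc w ^+ 2).
have K0 : 0 < K.
  by rewrite !mulr_gt0 ?invr_gt0 ?exprn_gt0 ?normr_gt0 ?normc_gt0 ?Im_neq0.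
apply/cvgrPdist_le => e e0; near=> n.
have n1 : (1 <= n)%N by near: n; exact: nbhs_infty_ge.
rewrite sub0r normrN ger0_norm ?normc_ge0//.
apply: le_trans (cauchy_transform_lipschitz _ _ iw0) _.
have := self_energy_clt EC n1 (pow n n1) we; rewrite expr1 => le1.
apply: le_trans (ler_wpM2l _ le1) _; first by rewrite divr_ge0 ?exprn_ge0.
(* The distance is at most K / sqrt n, hence at most e for such n. *)
have nK : (K / e) ^+ 2 < n%:R by near: n; exact: nbhs_infty_gtr.
have sK : K / e < Num.sqrt n%:R.
  rewrite -[K / e]ger0_norm; last by rewrite divr_ge0// ltW.
  by rewrite -sqrtr_sqr ltr_sqrt// (le_lt_trans _ nK)// sqr_ge0.
have s0 : 0 < Num.sqrt n%:R :> R by rewrite sqrtr_gt0 ltr0n.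
rewrite (_ : _ * _ = K / Num.sqrt n%:R); last first.
  by rewrite /K; field; rewrite !gt_eqF// normr_gt0.
rewrite ler_pdivrMr// mulrC -ler_pdivrMr// ltW//.
Unshelve. all: by end_near. Qed.

(** Near 1 and -1 continuity makes |h| <= e; elsewhere [phi] is bounded below, so a multiple of it
    dominates the bound M. *)
Lemma two_point_domination (M e : R) (h phi : R -> R) :
  continuous h -> (forall t, `|h t| <= M) -> h 1 = 0 -> h (- 1) = 0 ->
  (forall t, 0 <= phi t) ->
  (forall d, 0 < d -> exists2 K, 0 < K & forall t, d <= `|t ^+ 2 - 1| ->
    1 <= K * phi t) ->
  0 < e -> exists2 K : R, 0 <= K & forall t, `|h t| <= e + K * phi t.
Proof.
move=> ch hM h1 hN1 phi0 phiK e0.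
have M0 : 0 <= M by apply: le_trans (hM 0).
have near0 (a : R) : h a = 0 ->
    exists2 d : R, 0 < d & forall t, `|a - t| < d -> `|h t| <= e.
  move=> ha; have /cvgrPdist_le /(_ _ e0) /nbhs_ballP [d d0 hd] := ch a.
  exists d => // t td; have /= := hd t; rewrite ha sub0r normrN; apply.
  by rewrite -ball_normE.
have [d1 d10 hd1] := near0 _ h1; have [d2 d20 hd2] := near0 _ hN1.
have [K K0 phiK'] := phiK (Num.min d1 d2) ltac:(by rewrite lt_min d10).
exists (M * K); first by rewrite mulr_ge0// ltW.
move=> t; have [t1|t1] := ltP `|1 - t| d1.
  by apply: le_trans (hd1 t t1) _; rewrite lerDl !mulr_ge0// ltW.
have [t2|t2] := ltP `|- 1 - t| d2.
  by apply: le_trans (hd2 t t2) _; rewrite lerDl !mulr_ge0// ltW.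
(* One factor of t^2 - 1 = (1 - t)(-1 - t) has modulus at least 1, according to the sign of t; the
   other is the distance to 1 or to -1. *)
have far : Num.min d1 d2 <= `|t ^+ 2 - 1|.
  rewrite (_ : t ^+ 2 - 1 = (1 - t) * (- 1 - t)); last by ring.
  rewrite normrM ge_min; have [t0|t0] := leP 0 t.
    apply/orP; left; apply: le_trans t1 _; rewrite ler_peMr//.
    by rewrite ler0_norm; lra.
  apply/orP; right; apply: le_trans t2 _; rewrite ler_peMl//.
  by rewrite ger0_norm; lra.
apply: le_trans (hM t) _; rewrite -mulrA -[leLHS]mulr1 -[leLHS]add0r.
by apply: lerD; [exact: ltW|rewrite ler_wpM2l// phiK'].
Qed.

(** Constants and [psi] interpolate any values at 1 and -1. Subtracting the interpolant of f leaves
    a function h vanishing at both points, whose integral is controlled by that of [phi]. *)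
Lemma weakly_converges_two_point (mu_ : nat -> prob R) (phi psi : R -> R)
    (B : R) :
  continuous phi -> continuous psi ->
  (forall t, `|phi t| <= B) -> (forall t, `|psi t| <= B) ->
  (forall t, 0 <= phi t) ->
  (forall d, 0 < d -> exists2 K, 0 < K & forall t, d <= `|t ^+ 2 - 1| ->
    1 <= K * phi t) ->
  psi 1 != 0 -> psi (- 1) = - psi 1 ->
  \int[mu_ n]_t phi t @[n --> \oo] --> 0 ->
  \int[mu_ n]_t psi t @[n --> \oo] --> 0 ->
  weakly_converges mu_ rho_b.
Proof.
move=> cphi cpsi phiB psiB phi0 phiK psi1 psiN1 phi_cvg psi_cvg f cf [A [_ fA]].
(* Every number beyond A bounds |f|, and |A| + 1 is one. *)
have {}fA t : `|f t| <= `|A| + 1.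
  by apply: fA => //; rewrite ltr_pwDr// ler_norm.
rewrite Rintegral_rho_b; last exact: continuous_measurable_fun.
(* [a] and [b] are the even and odd interpolation coefficients of f at 1 and -1. *)
set a := (_ + _) / 2; pose b := (f 1 - f (- 1)) / (2 * psi 1).
pose h t := f t - (a + b * psi t).
have chh : continuous h.
  move=> t; apply: cvgB; first exact: cf.
  by apply: cvgD; [exact: cvg_cst|apply: cvgM; [exact: cvg_cst|exact: cpsi]].
have hM t : `|h t| <= `|A| + 1 + (`|a| + `|b| * B).
  rewrite (le_trans (ler_normB _ _))// lerD//.
  by rewrite (le_trans (ler_normD _ _))// lerD2l normrM ler_wpM2l.
have h1 : h 1 = 0 by rewrite /h /a /b; field.
have hN1 : h (- 1) = 0 by rewrite /h /a /b psiN1; field.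
apply/cvgrPdist_le => e e0; have e3 : 0 < e / 3 by rewrite divr_gt0.
have [K K0 hK] := two_point_domination chh hM h1 hN1 phi0 phiK e3.
near=> n.
(* Adding 1 to [K], and below to [|b|], avoids division by zero. *)
have phin : `|\int[mu_ n]_t phi t| <= e / 3 / (K + 1).
  rewrite -normrN -sub0r; near: n; move/cvgrPdist_le : phi_cvg; apply.
  by rewrite divr_gt0// ltr_wpDl.
have psin : `|\int[mu_ n]_t psi t| <= e / 3 / (`|b| + 1).
  rewrite -normrN -sub0r; near: n; move/cvgrPdist_le : psi_cvg; apply.
  by rewrite divr_gt0// ltr_wpDl.
have phii := continuous_bounded_integrable (mu_ n) cphi phiB.
have psii := continuous_bounded_integrable (mu_ n) cpsi psiB.
have hi := continuous_bounded_integrable (mu_ n) chh hM.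
have ci c := integrable_prob_cst (mu_ n) c.
have -> : \int[mu_ n]_t f t =
    a + b * \int[mu_ n]_t psi t + \int[mu_ n]_t h t.
  rewrite -{1}(Rintegral_prob_cst (mu_ n) a) -RintegralZl// -!RintegralD//.
  - by apply: eq_Rintegral => t _; rewrite /h; ring.
  - by apply: integrable_add => //; exact: integrable_scale.
  - exact: integrable_scale.
have hle : `|\int[mu_ n]_t h t| <= e / 3 + e / 3.
  have dom_i : (mu_ n).-integrable setT (EFin \o (fun t => e / 3 + K * phi t)).
    by apply: integrable_add => //; exact: integrable_scale.
  apply: le_trans (normr_Rintegral_le hi dom_i hK) _.
  rewrite RintegralD//; last exact: integrable_scale.
  rewrite Rintegral_prob_cst RintegralZl// lerD2l.
  apply: le_trans (ler_norm _) _; rewrite normrM (ger0_norm K0).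
  apply: le_trans (ler_wpM2l K0 phin) _.
  by rewrite mulrCA ger_pMr// ler_pdivrMr ?mul1r ?lerDl// ltr_wpDl.
have ble : `|b * \int[mu_ n]_t psi t| <= e / 3.
  rewrite normrM; apply: le_trans (ler_wpM2l (normr_ge0 _) psin) _.
  by rewrite mulrCA ger_pMr// ler_pdivrMr ?mul1r ?lerDl// ltr_wpDl.
rewrite -addrA opprD addrA subrr sub0r normrN.
apply: le_trans (ler_normD _ _) _; apply: le_trans (lerD ble hle) _.
lra.
Unshelve. all: by end_near. Qed.

End weak_convergence.

(** * Weak convergence from Cauchy transforms on the imaginary axis *)

Section convergence_to_bernoulli.
Context {R : realType}.

Lemma cvg_normc_lipschitz (f : R[i] -> R) (u : nat -> R[i]) (l : R[i]) :
  (forall z w, `|f z - f w| <= normc (z - w)) ->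
  normc (u n - l) @[n --> \oo] --> 0 -> f (u n) @[n --> \oo] --> f l.
Proof.
move=> flip /cvgrPdist_le ul; apply/cvgrPdist_le => e e0.
move: (ul e e0); apply: filterS => n /=; rewrite sub0r normrN => le_e.
rewrite distrC; apply: le_trans (flip _ _) _.
exact: le_trans (ler_norm _) le_e.
Qed.

Lemma cvg_ReIm (u : nat -> R[i]) (l : R[i]) :
  normc (u n - l) @[n --> \oo] --> 0 ->
  complex.Re (u n) @[n --> \oo] --> complex.Re l /\
  complex.Im (u n) @[n --> \oo] --> complex.Im l.
Proof.
move=> ul; split; apply: cvg_normc_lipschitz ul => z w.
- by apply: le_trans (Re_le_normc _); case: z w => a b [c d].
- by apply: le_trans (Im_le_normc _); case: z w => a b [c d].
Qed.

Lemma continuous_inv_sqr_add (y : R) : y != 0 ->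
  continuous (fun t : R => (t ^+ 2 + y ^+ 2)^-1).
Proof.
move=> y0 t; apply: cvgV; first by have := resolvent_den_neq0 0 t y0; rewrite sub0r sqrrN.
by apply: cvgD; [exact: exprn_continuous|exact: cvg_cst].
Qed.

Lemma inv_sqr_add_bound (y t : R) : y != 0 ->
  `|(t ^+ 2 + y ^+ 2)^-1| <= (y ^+ 2)^-1.
Proof.
move=> y0; have y2 : 0 < y ^+ 2 by rewrite lt_neqAle eq_sym sqrf_eq0 y0 sqr_ge0.
have ty : 0 < t ^+ 2 + y ^+ 2 by rewrite ltr_wpDl ?sqr_ge0.
by rewrite normfV (gtr0_norm ty) lef_pV2 ?posrE// lerDr sqr_ge0.
Qed.

Lemma mul_inv_sqr_add_bound (y t : R) : y != 0 ->
  `|t / (t ^+ 2 + y ^+ 2)| <= 1 + (y ^+ 2)^-1.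
Proof.
move=> y0; have := inv_sqr_add_bound t y0.
have y2 : 0 < y ^+ 2 by rewrite lt_neqAle eq_sym sqrf_eq0 y0 sqr_ge0.
have ty : 0 < t ^+ 2 + y ^+ 2 by rewrite ltr_wpDl ?sqr_ge0.
rewrite normrM normfV (gtr0_norm ty) => ky.
have t2 : `|t| <= t ^+ 2 + 1.
  by rewrite -real_normK ?num_real//; have := sqr_ge0 (`|t| - 2^-1); nra.
apply: (@le_trans _ _ ((t ^+ 2 + 1) / (t ^+ 2 + y ^+ 2))).
  by rewrite ler_wpM2r// invr_ge0 ltW.
rewrite mulrDl mul1r lerD// ler_pdivrMr// mul1r lerDl ltW//.
Qed.

(** Integrates 1 / (i y - t) = - (t + i y) / (t^2 + y^2) by parts real and imaginary. *)
Lemma cauchy_transform_imaginary (nu : prob R) (y : R) : 0 < y ->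
  complex.Re (cauchy_transform nu (0 +i* y)) =
    - (\int[nu]_t (t / (t ^+ 2 + y ^+ 2))) /\
  complex.Im (cauchy_transform nu (0 +i* y)) =
    - y * \int[nu]_t (t ^+ 2 + y ^+ 2)^-1.
Proof.
move=> y0; have yn : y != 0 by rewrite gt_eqF.
have ki := continuous_bounded_integrable nu (continuous_inv_sqr_add yn)
  (fun t => inv_sqr_add_bound t yn).
have ci : continuous (fun t : R => t / (t ^+ 2 + y ^+ 2)).
  by move=> t; apply: cvgM; [exact: cvg_id|exact: continuous_inv_sqr_add].
have li := continuous_bounded_integrable nu ci
  (fun t => mul_inv_sqr_add_bound t yn).
split.
- transitivity (\int[nu]_t complex.Re (1 / ((0 +i* y) - t%:C))) => //.
  rewrite -[RHS]mulN1r -[RHS]RintegralZl//; apply: eq_Rintegral => t _.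
  by rewrite resolvent_ReIm//= sub0r sqrrN mulN1r mulNr.
- transitivity (\int[nu]_t complex.Im (1 / ((0 +i* y) - t%:C))) => //.
  rewrite -[RHS]RintegralZl//; apply: eq_Rintegral => t _.
  by rewrite resolvent_ReIm//= sub0r sqrrN mulNr.
Qed.

(* For [s = t^2 >= 0] and [|s - 1| >= d] one has
   [s + a <= |s - 1| (1 + (a + 1) / d)], and likewise for [b]. *)
Lemma two_point_penalty_lower (a b d : R) : 0 < a -> 0 < b -> 0 < d ->
  exists2 K, 0 < K & forall t : R, d <= `|t ^+ 2 - 1| ->
    1 <= K * ((t ^+ 2 - 1) ^+ 2 / ((t ^+ 2 + a) * (t ^+ 2 + b))).
Proof.
move=> a0 b0 d0; exists ((1 + (a + 1) / d) * (1 + (b + 1) / d)).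
  by rewrite mulr_gt0// addr_gt0// divr_gt0// addr_gt0.
move=> t dt; have t2 := sqr_ge0 t.
have bound c : 0 < c -> t ^+ 2 + c <= (1 + (c + 1) / d) * `|t ^+ 2 - 1|.
  move=> c0; rewrite mulrDl mul1r.
  have := ler_norm (t ^+ 2 - 1).
  have : c + 1 <= (c + 1) / d * `|t ^+ 2 - 1|.
    by rewrite mulrAC ler_pdivlMr// ler_pM2l// addr_gt0.
  lra.
have ta : 0 < t ^+ 2 + a by rewrite ltr_wpDl.
have tb : 0 < t ^+ 2 + b by rewrite ltr_wpDl.
rewrite mulrA ler_pdivlMr ?mulr_gt0// mul1r.
rewrite -[(t ^+ 2 - 1) ^+ 2]real_normK ?num_real// expr2 mulrACA.
by rewrite ler_pM ?bound// ltW.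
Qed.

Lemma weakly_converges_clt (eps C : R) (mu : prob R) (mu_ : nat -> prob R) :
  0 < eps -> 0 < C ->
  (forall w, truncated_cone eps eps w ->
    normc (self_energy mu (1 / w) - w) <= C * normc w ^+ 2) ->
  (forall n, (1 <= n)%N -> is_bool_pow mu n (mu_ n)) ->
  weakly_converges (fun n => dilate (1 / Num.sqrt n%:R) (mu_ n)) rho_b.
Proof.
move=> e0 C0 EC pow; set nu_ := fun n => _.
have cvg_y (y : R) : 0 < y -> eps^-1 < y ->
    \int[nu_ n]_t (t / (t ^+ 2 + y ^+ 2)) @[n --> \oo] --> 0 /\
    \int[nu_ n]_t (t ^+ 2 + y ^+ 2)^-1 @[n --> \oo] --> (1 + y ^+ 2)^-1.
  move=> y0 ey; have yn : y != 0 by rewrite gt_eqF.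
  (* The condition y > 1/eps places -i/y in the cone, and its inverse is i y. *)
  have we : truncated_cone eps eps (0 -i* y^-1).
    rewrite /truncated_cone/= normr0 mulNr mulrN opprK; split.
    - by rewrite oppr_lt0 invr_gt0.
    - by rewrite divr_gt0.
    - by rewrite ltrN2 -[eps]invrK ltf_pV2 ?posrE ?invr_gt0.
  have wE : 1 / (0 -i* y^-1) = 0 +i* y.
    rewrite mul1r; apply/eqP; rewrite eq_complex /= mul0r eqxx/=.
    by apply/eqP; field.
  have [] := cvg_ReIm (cvg_cauchy_transform C0 EC pow we).
  rewrite wE; have [-> ->] := cauchy_transform_imaginary rho_b y0.
  have -> : (fun n => complex.Re (cauchy_transform (nu_ n) (0 +i* y))) =
      (fun n => - \int[nu_ n]_t (t / (t ^+ 2 + y ^+ 2))).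
    by apply/funext => n; have [] := cauchy_transform_imaginary (nu_ n) y0.
  have -> : (fun n => complex.Im (cauchy_transform (nu_ n) (0 +i* y))) =
      (fun n => - y * \int[nu_ n]_t (t ^+ 2 + y ^+ 2)^-1).
    by apply/funext => n; have [] := cauchy_transform_imaginary (nu_ n) y0.
  have ck := continuous_inv_sqr_add yn.
  have ckt : continuous (fun t : R => t / (t ^+ 2 + y ^+ 2)).
    by move=> t; apply: cvgM; [exact: cvg_id|exact: ck].
  rewrite !Rintegral_rho_b; [|exact: continuous_measurable_fun..].
  move=> cr0 ci; have cr := cvgN cr0; split.
  (* The integrand is odd, so its values at 1 and -1 cancel. *)
  - have E0 : - - ((1 / (1 ^+ 2 + y ^+ 2) + -1 / ((-1) ^+ 2 + y ^+ 2)) / 2) = 0 :> R.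
      by rewrite sqrrN opprK; lra.
    rewrite -[X in _ --> X]E0 (_ : (fun n => _) = (fun n =>
        - - \int[nu_ n]_t (t / (t ^+ 2 + y ^+ 2)))); first exact: cr.
    by apply/funext => n; rewrite opprK.
  - have E0 : (- y)^-1 *
        (- y * (((1 ^+ 2 + y ^+ 2)^-1 + ((-1) ^+ 2 + y ^+ 2)^-1) / 2)) =
        (1 + y ^+ 2)^-1.
      by rewrite mulKf ?oppr_eq0// sqrrN expr1n; lra.
    rewrite -[X in _ --> X]E0 (_ : (fun n => _) = (fun n =>
        (- y)^-1 * (- y * \int[nu_ n]_t (t ^+ 2 + y ^+ 2)^-1))).
      by apply: cvgM; [exact: cvg_cst|exact: ci].
    by apply/funext => n; rewrite mulKf ?oppr_eq0.
(* Two distinct heights above 1/eps. *)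
pose y := eps^-1 + 1; pose x := eps^-1 + 2.
have ie0 : 0 < eps^-1 by rewrite invr_gt0.
have y0 : 0 < y by rewrite /y; lra.
have x0 : 0 < x by rewrite /x; lra.
have yn : y != 0 by rewrite gt_eqF.
have xn : x != 0 by rewrite gt_eqF.
have [psi_cvg ky_cvg] := cvg_y y y0 ltac:(by rewrite ltrDl).
have [_ kx_cvg] := cvg_y x x0 ltac:(by rewrite ltrDl).
have xy : x ^+ 2 - y ^+ 2 != 0.
  rewrite subr_sqr mulf_neq0//; first by rewrite /x /y gt_eqF//; lra.
  by rewrite gt_eqF// addr_gt0.
(* With s = t^2, [P] and [Q] are the residues of (s - 1)^2 / ((s + y^2)(s + x^2)) at s = -y^2 and s
   = -x^2; its value at infinity is 1. *)
pose P := (y ^+ 2 + 1) ^+ 2 / (x ^+ 2 - y ^+ 2).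
pose Q := - ((x ^+ 2 + 1) ^+ 2 / (x ^+ 2 - y ^+ 2)).
pose phi (t : R) := 1 + (P * (t ^+ 2 + y ^+ 2)^-1 + Q * (t ^+ 2 + x ^+ 2)^-1).
have y2 : 0 < y ^+ 2 by rewrite exprn_gt0.
have x2 : 0 < x ^+ 2 by rewrite exprn_gt0.
have phiE t : phi t =
    (t ^+ 2 - 1) ^+ 2 / ((t ^+ 2 + y ^+ 2) * (t ^+ 2 + x ^+ 2)).
  rewrite /phi /P /Q; have t2 := sqr_ge0 t; field.
  by rewrite xy !gt_eqF// ltr_wpDl.
have cy := continuous_inv_sqr_add yn; have cx := continuous_inv_sqr_add xn.
have phi_cvg : \int[nu_ n]_t phi t @[n --> \oo] --> 0.
  (* The limits of the two integrals are the integrands at t = 1, so the limit is phi(1) = 0. *)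
  have -> : 0 = 1 + (P * (1 + y ^+ 2)^-1 + Q * (1 + x ^+ 2)^-1).
    have := phiE 1; rewrite /phi expr1n => ->.
    by rewrite subrr expr0n/= mul0r.
  rewrite (_ : (fun n => _) = (fun n => 1 + (P * \int[nu_ n]_t (t ^+ 2 + y ^+ 2)^-1
      + Q * \int[nu_ n]_t (t ^+ 2 + x ^+ 2)^-1))); last first.
    apply/funext => n.
    have iy := continuous_bounded_integrable (nu_ n) cy
      (fun t => inv_sqr_add_bound t yn).
    have ix := continuous_bounded_integrable (nu_ n) cx
      (fun t => inv_sqr_add_bound t xn).
    have i1 := integrable_prob_cst (nu_ n) 1.
    rewrite !RintegralD// ?RintegralZl// ?Rintegral_prob_cst//;
      try exact: integrable_scale.
    by apply: integrable_add; exact: integrable_scale.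
  apply: cvgD; first exact: cvg_cst.
  by apply: cvgD; apply: cvgM => //; exact: cvg_cst.
(* A sum of bounds for [phi] and for [psi], so that one constant serves both. *)
pose B := (1 + (`|P| * (y ^+ 2)^-1 + `|Q| * (x ^+ 2)^-1)) + (1 + (y ^+ 2)^-1).
apply: (@weakly_converges_two_point _ nu_ phi
  (fun t => t / (t ^+ 2 + y ^+ 2)) B) => //.
- move=> t; apply: cvgD; first exact: cvg_cst.
  by apply: cvgD; apply: cvgM; try exact: cvg_cst; [exact: cy|exact: cx].
- by move=> t; apply: cvgM; [exact: cvg_id|exact: cy].
- move=> t; rewrite /B; apply: ler_wpDr.
    by rewrite addr_ge0// invr_ge0 ltW.
  rewrite (le_trans (ler_normD _ _))// normr1 lerD2l.
  rewrite (le_trans (ler_normD _ _))// !normrM lerD// ler_wpM2l//;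
    exact: inv_sqr_add_bound.
- move=> t; apply: le_trans (mul_inv_sqr_add_bound t yn) _.
  by rewrite /B lerDr !addr_ge0// mulr_ge0// invr_ge0 ltW.
- move=> t; rewrite phiE divr_ge0 ?sqr_ge0// mulr_ge0// addr_ge0 ?sqr_ge0//; exact: ltW.
- move=> d d0; have [K K0 hK] := two_point_penalty_lower y2 x2 d0.
  by exists K => // t /hK; rewrite phiE.
- by rewrite expr1n mul1r invr_eq0 gt_eqF// addr_gt0.
- by rewrite sqrrN mulNr.
Qed.

End convergence_to_bernoulli.

Theorem theorem3p2 (R : realType) (eps : R) (eps_gt0 : 0 < eps)
    (eps_small : truncated_cone eps eps `<=`
       [set z : R[i] | normc (z + (0 +i* (1 / 4))) < 1 / 4])
    (mu : prob R) (mu_std : standardized 3 mu) :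
  [/\ exists2 C : R, 0 < C & forall (n : nat) (mu_n : prob R), (1 <= n)%N ->
        is_bool_pow mu n mu_n ->
        (dBool eps 2 (dilate (1 / Num.sqrt n%:R) mu_n) rho_b
          <= ((`|moment 3 mu| + C) / Num.sqrt n%:R)%:E)%E,
      forall mu_ : nat -> prob R,
        (forall n : nat, (1 <= n)%N -> is_bool_pow mu n (mu_ n)) ->
        weakly_converges (fun n => dilate (1 / Num.sqrt n%:R) (mu_ n)) rho_b
    & moment 3 mu = 0 -> finite_moment 4 mu ->
      exists2 C : R, 0 < C & forall (n : nat) (mu_n : prob R), (1 <= n)%N ->
        is_bool_pow mu n mu_n ->
        (dBool eps 3 (dilate (1 / Num.sqrt n%:R) mu_n) rho_b
          <= ((`|moment 4 mu| + C) / n%:R)%:E)%E].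
Proof.
have [fm mean0 var1] := mu_std.
have std2 : standardized 2 mu by split=> // k k2; apply: fm; exact: leqW.
have mass1 : moment 0 mu = 1 by exact/moment0.
have [C C0 EC] : exists2 C : R, 0 < C & forall w, truncated_cone eps eps w ->
    normc (self_energy mu (1 / w) - w) <= C * normc w ^+ 2.
  (* With N = 3 the moments 1, 0, 1 reduce the sum to w + w^3, with remainder of order |w|^4, that
     is p = 2. *)
  have [K K0 gK] := moment_expansion_cone eps_gt0 fm.
  apply: (self_energy_estimate (p := 2) eps_gt0 K0 _ std2) => // w we.
  apply: le_trans (gK w we).
  rewrite !big_ord_recl big_ord0/= mass1 mean0 var1 !mulr1 mulr0 add0r addr0.
  by rewrite expr1 opprD addrA.
split.
- exists C => // n mu_n n1 pow.
  apply: le_trans (dBool_clt EC n1 pow) _.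
  by rewrite expr1 lee_fin ler_wpM2r ?invr_ge0 ?sqrtr_ge0// lerDr.
- move=> mu_ pow; exact: weakly_converges_clt eps_gt0 C0 EC pow.
- move=> m3 f4.
  have fm4 k : (k <= 4)%N -> finite_moment k mu.
    by rewrite leq_eqVlt => /predU1P[->|]; [|exact: fm].
  have [D D0 ED] : exists2 D : R, 0 < D & forall w, truncated_cone eps eps w ->
      normc (self_energy mu (1 / w) - w) <= D * normc w ^+ 3.
    (* With N = 4 the vanishing third moment leaves the same sum and a remainder of order |w|^5,
       that is p = 3. *)
    have [K K0 gK] := moment_expansion_cone eps_gt0 fm4.
    apply: (self_energy_estimate (p := 3) eps_gt0 K0 _ std2) => // w we.
    apply: le_trans (gK w we).
    rewrite !big_ord_recl big_ord0/= mass1 mean0 var1 m3 !mulr1 !mulr0 add0r !addr0.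
    by rewrite expr1 opprD addrA.
  exists D => // n mu_n n1 pow.
  apply: le_trans (dBool_clt ED n1 pow) _.
  by rewrite sqr_sqrtr// lee_fin ler_wpM2r ?invr_ge0// lerDr.
Qed.
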